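(* Let $(\mathfrak X,\|\cdot\|)$ be a Banach space with dual $\mathfrak X^*$, let $(\Omega,\mathfrak L,\lambda)$ be a measure space, and let $\mathrm F:\mathfrak X\times\Omega\to\mathbb R$ be a function such that $\mathrm F(u,\cdot)\in L^\infty(\Omega,\lambda)$ for all $u\in\mathfrak X$, and $\mathrm F(\cdot,x)\in C^1(\mathfrak X)$ (in the Fréchet sense) for $\lambda$-a.e. $x\in\Omega$, with partial Fréchet differential $\partial \mathrm F(\cdot,x):\mathfrak X\to\mathfrak X^*$, $u\mapsto(\partial \mathrm F(\cdot,x))_u$. Suppose in addition that for every $v\in\mathfrak X$: (a) for every $\phi\in\mathfrak X$, $$\lambda\text{-}\operatorname*{ess\,sup}_{x\in\Omega}\Big|\big[(\partial \mathrm F(\cdot,x))_w-(\partial \mathrm F(\cdot,x))_v\big](\phi)\Big|\longrightarrow0\quad\text{as } w\to v\text{ in }\mathfrak X;$$ (b) $$\lambda\text{-}\operatorname*{ess\,sup}_{x\in\Omega}\big|\mathrm F(w,x)-\mathrm F(v,x)\big|\longrightarrow0\quad\text{as } w\to v\text{ in }\mathfrak X.$$ Let $f:\mathfrak X\to\mathbb R$ be given by $$f(u):=\lambda\text{-}\operatorname*{ess\,sup}_{x\in\Omega}\mathrm F(u,x).$$ Then $f$ is directionally (Gateaux) semi-differentiable everywhere on $\mathfrak X$, and its right semi-differential is given by $$(\mathfrak D f)^+_u(\phi)=\lim_{\varepsilon\to0^+}\Big(\lambda\text{-}\operatorname*{ess\,sup}_{x\in\Omega_\varepsilon(u)}(\partial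 \mathrm F(\cdot,x))_u(\phi)\Big)$$ for all $u,\phi\in\mathfrak X$, where, for $\varepsilon>0$, $$\Omega_\varepsilon(u):=\Big\{\hat x\in\Omega:\ \mathrm F(u,\hat x)\ge\lambda\text{-}\operatorname*{ess\,sup}_{x\in\Omega}\mathrm F(u,x)-\varepsilon\Big\}.$$
   Context: For a functional $f:\mathfrak X\to\mathbb R$ and $u,\phi\in\mathfrak X$, the right Gateaux semi-derivative of $f$ at $u$ in the direction $\phi$ is $(\mathfrak D f)^+_u(\phi):=\lim_{t\to0^+}\frac{f(u+t\phi)-f(u)}{t}$, whenever the limit exists; $f$ is Gateaux semi-differentiable at $u$ if this limit exists for all $\phi\in\mathfrak X$. (The left semi-derivative is the limit as $t\to0^-$, and equals $-(\mathfrak D f)^+_u(-\phi)$.) *)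

(* Defs.v *)
From mathcomp Require Import all_boot all_order all_algebra.
From mathcomp Require Import all_classical all_reals all_analysis ess_sup_inf.

Set Implicit Arguments.
Unset Strict Implicit.
Unset Printing Implicit Defensive.

Import Order.TTheory GRing.Theory Num.Theory.
Import numFieldNormedType.Exports.

Local Open Scope classical_set_scope.
Local Open Scope ring_scope.

Section GateauxSemiDerivative.
Context {R : realType} {X : normedModType R}.
Implicit Types (f : X -> R) (u phi : X).

Definition semi_quotient f u phi (t : R) : R := (f (u + t *: phi) - f u) / t.

Definition gateaux_semi_differentiable f u : Prop :=
  forall phi, cvg (semi_quotient f u phi t @[t --> 0^'+]).

(* A total function, meaningful only when the limit exists. *)
Definition right_semi_derivative f u phi : R :=
  lim (semi_quotient f u phi t @[t --> 0^'+]).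

End GateauxSemiDerivative.

Section FrechetC1.
Context {R : realType} {X : normedModType R}.

Definition dual_norm (l : X -> R) : \bar R :=
  ereal_sup [set `|l phi|%:E | phi in [set phi | `|phi| <= 1]].

(* [differentiable] includes the continuity of the linear form ['d g u], so
   that ['d g] takes its values in the topological dual of [X]. *)
Definition frechet_C1 (g : X -> R) : Prop :=
  (forall u, differentiable g u) /\
  (forall u, dual_norm ('d g w \- 'd g u) @[w --> u] --> 0%E).

End FrechetC1.

Section EssentialSupremum.
Context {d : measure_display} {T : measurableType d} {R : realType}.
Variable mu : {measure set T -> \bar R}.

Definition ess_sup_on (A : set T) (h : T -> \bar R) : \bar R :=
  ereal_inf [set y | \forall x \ae mu, A x -> (h x <= y)%E].

Lemma ess_sup_onT (h : T -> \bar R) : ess_sup_on setT h = ess_sup mu h.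
Proof.
congr ereal_inf; apply/seteqP; split => y /=.
  by apply: filterS => x; apply.
by apply: filterS => x.
Qed.

Lemma ess_sup_on_mrestr (A : set T) (mA : measurable A) (h : T -> \bar R) :
  ess_sup_on A h = ess_sup (mrestr mu mA) h.
Proof.
congr ereal_inf; apply/seteqP; split => y /= [N [mN N0 sN]].
- exists (N `|` ~` A); split.
  + exact: measurableU mN (measurableC mA).
  + rewrite /= /mrestr setIUl setICl setU0.
    apply: (subset_measure0 _ mN _ N0); first exact: measurableI.
    exact: subIsetl.
  + move=> x /= hx; have [Ax|nAx] := pselect (A x); last by right.
    by left; apply: sN => /= H; apply: hx; exact: H.
- exists (N `&` A); split => //; first exact: measurableI.
  move=> x /= /not_implyP[Ax hx]; split => //.
  exact: sN.
Qed.

(* The set of points where [g] is within [eps] of its essential supremum. *)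
Definition near_ess_sup (g : T -> R) (eps : R) : set T :=
  [set x | (ess_sup mu (EFin \o g) - eps%:E <= (g x)%:E)%E].

End EssentialSupremum.

(* Main.v *)
(* Fix u and phi and write D x for the differential of F(., x) at u applied to
   phi. Hypothesis (a) yields F(u + t phi, x) = F(u, x) + t D x + o(t) as
   t -> 0+, uniformly for almost every x. With g(eps) the essential supremum of
   D over the set where F(u, .) >= f(u) - eps, and l the limit of g at 0+:
   - on that set F(u + t phi, .) >= f(u) - eps + t D - o(t), and g(eps) >= l
     for every eps > 0, so f(u + t phi) >= f(u) + t l - o(t);
   - for fixed eps and t small compared with eps, the points outside that set
     are irrelevant to the essential supremum of F(u + t phi, .), because D is
     essentially bounded, so f(u + t phi) <= f(u) + t g(eps) + o(t). *)
Require Import Defs.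
From mathcomp Require Import all_boot all_order all_algebra.
From mathcomp Require Import all_classical all_reals all_analysis ess_sup_inf.
From mathcomp Require Import ring lra.

Import Order.TTheory GRing.Theory Num.Theory.
Import numFieldNormedType.Exports.

Local Open Scope classical_set_scope.
Local Open Scope ring_scope.

Lemma cvge_near_le {R : realType} {T : Type} {G : set_system T}
    {FG : Filter G} {h : T -> \bar R} {l c : R} :
  h x @[x --> G] --> l%:E -> l < c -> \forall x \near G, (h x <= c%:E)%E.
Proof.
move=> /fine_cvgP[hfin hl] lc.
apply: filterS2 hfin (cvgr_le _ hl _ lc) => x hx.
by rewrite -[in X in _ -> X](fineK hx) lee_fin.
Qed.

(** * Differentials of C^1 functions along a line *)

Section line.
Context {R : realType} {X : normedModType R}.
Implicit Types (g : X -> R) (u w phi : X).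

Lemma is_derive_line g u phi (s : R) : differentiable g (u + s *: phi) ->
  is_derive s 1 (fun r => g (u + r *: phi)) ('d g (u + s *: phi) phi).
Proof.
move=> dg.
have E : (fun h : R => h^-1 *: (((fun r => g (u + r *: phi)) \o shift s) (h *: 1)
            - g (u + s *: phi)) : R) =
         (fun h : R => h^-1 *: ((g \o shift (u + s *: phi)) (h *: phi)
            - g (u + s *: phi))).
  apply/funext => h /=; congr (_ *: (g _ - _)).
  by rewrite scalerDl /GRing.scale /= mulr1 addrCA.
split; first by rewrite /derivable E; exact: diff_derivable.
by rewrite -deriveE// /derive E.
Qed.

Lemma frechet_C1_cvg g u phi : frechet_C1 g ->
  'd g w phi @[w --> u] --> 'd g u phi.
Proof.
move=> [_ /(_ u) Cg]; apply/cvgrPdist_le => e e0.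
(* Dividing [phi] by its norm plus 1 puts it in the unit ball, where [dual_norm] controls the value;
   the added 1 covers [phi = 0]. *)
have n0 : 0 < `|phi| + 1 by rewrite ltr_wpDl.
have : \forall w \near u,
    (dual_norm ('d g w \- 'd g u)%R <= (e / (`|phi| + 1))%:E)%E.
  exact: (cvge_near_le Cg (divr_gt0 e0 n0)).
apply: filterS => w; apply: contraLR; rewrite -!ltNge => H.
apply: (@lt_le_trans _ _ (`|('d g w \- 'd g u) ((`|phi| + 1)^-1 *: phi)|%:E)); last first.
  apply: ereal_sup_ubound; exists ((`|phi| + 1)^-1 *: phi) => //=.
  rewrite normrZ gtr0_norm ?invr_gt0// mulrC ler_pdivrMr// mul1r.
  by rewrite lerDl.
rewrite lte_fin /= !linearZ /= -scalerDr normrZ gtr0_norm ?invr_gt0//.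
by rewrite [X in _ < X]mulrC distrC ltr_pM2r ?invr_gt0.
Qed.

(** Density of the rationals and continuity of the differential carry the bound to every real [s] in
    []0, delta[]; the mean value theorem on [[0, t]] then gives the estimate. *)
Lemma frechet_C1_increment g u phi (delta e : R) : frechet_C1 g ->
  (forall q : rat, ratr q \in `]0, delta[ ->
    `|'d g (u + ratr q *: phi) phi - 'd g u phi| <= e) ->
  forall t, 0 < t < delta ->
    `|g (u + t *: phi) - g u - t * 'd g u phi| <= e * t.
Proof.
move=> Cg rat_le t /andP[t0 tdelta].
have le_e s : s \in `]0, delta[ ->
    `|'d g (u + s *: phi) phi - 'd g u phi| <= e.
  rewrite in_itv /= => /andP[s0 sdelta]; rewrite leNgt; apply/negP => lt_e.
  have cs : `|'d g (u + r *: phi) phi - 'd g u phi| @[r --> s] -->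
            `|'d g (u + s *: phi) phi - 'd g u phi|.
    apply: cvg_norm; apply: cvgB; last exact: cvg_cst.
    apply: (@cvg_comp _ _ _ (fun r : R => u + r *: phi) (fun w => 'd g w phi)
              _ (nbhs (u + s *: phi))); last exact: frechet_C1_cvg.
    by apply: cvgD; [exact: cvg_cst|apply: cvgZr_tmp; exact: cvg_id].
  have [r r0 Hr] : \forall r \near s, e < `|'d g (u + r *: phi) phi - 'd g u phi|.
    exact: (cvgr_gt _ cs).
  (* Approaching [s] from the left keeps [q] below [delta]; the maximum with 0 keeps it positive. *)
  have /rat_in_itvoo[q] : Num.max 0 (s - r) < s.
    by rewrite gt_max s0 /= ltrBlDr ltrDl.
  rewrite in_itv /= gt_max => /andP[/andP[q0 qr] qs].
  have : e < `|'d g (u + ratr q *: phi) phi - 'd g u phi|.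
    by apply: Hr; rewrite /= gtr0_norm ?subr_gt0// ltrBlDr addrC -ltrBlDr.
  by rewrite ltNge rat_le ?in_itv/= ?q0 ?(lt_trans qs).
have dline (s : R) : is_derive s 1 (fun r => g (u + r *: phi)) ('d g (u + s *: phi) phi).
  exact/is_derive_line/(Cg.1).
have cline : {within `[0, t], continuous (fun r => g (u + r *: phi))}.
  by apply: derivable_within_continuous => s _; exact: ex_derive.
have [c] := MVT t0 (fun s _ => dline s) cline.
rewrite in_itv/= scale0r addr0 subr0 => /andP[c0 ct] ->.
rewrite mulrC -mulrBr normrM gtr0_norm// mulrC ler_wpM2r ?(ltW t0)//.
by apply: le_e; rewrite in_itv /= c0 (lt_trans ct).
Qed.

End line.

(** * Essential suprema and almost everywhere bounds *)

Section ess.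
Context {d : measure_display} {T : measurableType d} {R : realType}.
Variable mu : {measure set T -> \bar R}.

(** Extending [h] by [-oo] off [A] turns this into the known characterisation of bounds on
    [ess_sup]. *)
Lemma ess_sup_onP (A : set T) (h : T -> \bar R) (y : \bar R) :
  (ess_sup_on mu A h <= y)%E <-> \forall x \ae mu, A x -> (h x <= y)%E.
Proof.
pose hA := patch (fun=> -oo%E) A h.
have hAP x z : (hA x <= z)%E <-> (A x -> (h x <= z)%E).
  rewrite /hA /patch; case: ifPn => [/set_mem Ax|/negP nAx].
    by split=> [//|]; exact.
  by split=> [_ Ax|_]; [case: nAx; exact: mem_set|exact: leNye].
have -> : ess_sup_on mu A h = ess_sup mu hA.
  congr ereal_inf; apply/seteqP.
  by split=> z /=; apply: filterS => x /hAP.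
by split=> [/ess_supP|H]; [|apply/ess_supP; move: H]; apply: filterS => x /hAP.
Qed.

Lemma ae_forall_countable (I : countType) (P : I -> T -> Prop) :
  (forall i, \forall x \ae mu, P i x) -> \forall x \ae mu, forall i, P i x.
Proof.
move=> aeP.
have : \forall x \ae mu, forall n, if unpickle n is Some i then P i x else True.
  by apply: ae_foralln => n; case: unpickle => [i|]; [exact: aeP|exact: nearW].
by apply: filterS => x Px i; have := Px (pickle i); rewrite pickleK.
Qed.

Lemma Lfun_oo_bounded (h : T -> R) : h \in Lfun mu +oo%E ->
  exists M, \forall x \ae mu, `|h x| <= M.
Proof.
rewrite inE => /andP[_]; rewrite inE /finite_norm unlock /=.
case: ifPn => [_ |]; first exact: ess_supr_bounded.
(* If the whole space is null, the norm is 0 by convention and says nothing about [h], but every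
   property holds almost everywhere. *)
rewrite -leNgt measure_le0 => /eqP mu0 _; exists 0.
by exists setT; split.
Qed.

(** * Right derivative of an essential supremum under a uniform expansion *)

Section right_derivative.
Variables (a D : T -> R) (b : R -> T -> R) (alpha : R) (beta : R -> R) (M : R).
Hypothesis aE : alpha%:E = ess_sup mu (EFin \o a).
Hypothesis bE : forall t, (beta t)%:E = ess_sup mu (EFin \o b t).
Hypothesis M0 : 0 <= M.
Hypothesis DM : \forall x \ae mu, `|D x| <= M.
Hypothesis ab : forall eta, 0 < eta -> \forall t \near 0^'+,
  \forall x \ae mu, `|b t x - a x - t * D x| <= eta * t.

Let g (eps : R) : \bar R :=
  ess_sup_on mu (near_ess_sup mu a eps) (EFin \o D).

Let nearE (eps : R) x : near_ess_sup mu a eps x <-> alpha - eps <= a x.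
Proof. by rewrite /near_ess_sup /= -aE -EFinB lee_fin. Qed.

(** Otherwise [alpha - eps] would be an essential upper bound of [a] below its essential
    supremum. *)
Let near_ess_sup_nonnull (eps : R) : 0 < eps ->
  ~ \forall x \ae mu, ~ near_ess_sup mu a eps x.
Proof.
move=> eps0 Nx; have : (ess_sup mu (EFin \o a) <= (alpha - eps)%:E)%E.
  apply/ess_supP; apply: filterS Nx => x /nearE /negP.
  by rewrite -ltNge lee_fin => /ltW.
by rewrite -aE lee_fin; lra.
Qed.

(** A bound [y < - M] would force the near-maximal set to be null. This keeps the limit of [g] away
    from [-oo]. *)
Let g_ge (eps y : R) : 0 < eps -> (g eps <= y%:E)%E -> - M <= y.
Proof.
move=> eps0 /ess_sup_onP gy; rewrite leNgt; apply/negP => yM.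
apply: (near_ess_sup_nonnull eps eps0).
apply: filterS2 gy DM => x /= gy; rewrite ler_norml => /andP[Dx _] /gy.
by rewrite lee_fin; lra.
Qed.

Lemma ess_sup_right_derivative : exists l : R,
  ess_sup_on mu (near_ess_sup mu a eps) (EFin \o D) @[eps --> 0^'+] --> l%:E /\
  (beta t - alpha) / t @[t --> 0^'+] --> l.
Proof.
pose L := ereal_inf [set g eps | eps in `]0, +oo[].
(* The near-maximal sets grow with [eps], so [g] is nondecreasing and its right limit at 0 is its
   infimum. *)
have g_cvg : g eps @[eps --> 0^'+] --> L.
  apply: nondecreasing_at_right_cvge => // e1 e2 _ _ e12.
  apply/ess_sup_onP; have /ess_sup_onP := lexx (g e2).
  by apply: filterS => x gx /nearE ax; apply/gx/nearE; lra.
have L_le eps : 0 < eps -> (L <= g eps)%E.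
  by move=> eps0; apply: ereal_inf_lbound; exists eps => //=; rewrite in_itv/= eps0.
have g_le eps : (g eps <= M%:E)%E.
  apply/ess_sup_onP; apply: filterS DM => x; rewrite ler_norml => /andP[_ Dx] _.
  by rewrite /= lee_fin.
have L_ge : ((- M)%:E <= L)%E.
  apply: le_ereal_inf_tmp => _ [eps /= + <-]; rewrite in_itv/= andbT => eps0.
  have gM y : (g eps <= y%:E)%E -> - M <= y by exact: g_ge.
  rewrite leNgt; apply/negP => gltM.
  have [y /andP[gy yM]] : exists y : R, (g eps <= y%:E)%E && (y < - M).
    case: (g eps) gltM => [r| |] //=; last by exists (- M - 1); rewrite leNye; lra.
    by rewrite lte_fin => ?; exists r; rewrite lexx.
  by have := gM _ gy; lra.
have [l Ll] : exists l, L = l%:E.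
  have := le_trans (L_le 1 ltr01) (g_le 1).
  by case: (L) L_ge => [l| |] //; exists l.
rewrite Ll in g_cvg L_le L_ge; rewrite lee_fin in L_ge.
exists l; split => //; apply/cvgrPdist_le => eta eta0.
have eta20 : 0 < eta / 2 by lra.
have [e0 [e00 ge0]] : exists e0, 0 < e0 /\ (g e0 <= (l + eta / 2)%:E)%E.
  have : \forall e \near 0^'+, 0 < e /\ (g e <= (l + eta / 2)%:E)%E.
    have : \forall e \near 0^'+, (g e <= (l + eta / 2)%:E)%E.
      by apply: (cvge_near_le g_cvg); lra.
    apply: filterS2; last exact: nbhs_right_gt.
    by move=> e.
  exact: filter_ex.
(* Taking [t < e0 / (2 * M + 1)] gives [2 * M * t <= e0]. Where [a x < alpha - e0], the main part
   [a x + t * D x] is then at most [alpha - t * M], hence at most [alpha + t * l] since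
   [- M <= l]. *)
have M1 : 0 < 2 * M + 1 by move: M0; lra.
apply: filterS3 (ab _ eta20) (nbhs_right_gt 0) (nbhs_right_lt (divr_gt0 e00 M1)).
move=> t abt t0 te0.
have tM : t * (2 * M) <= e0.
  by move: te0; rewrite ltr_pdivlMr//; lra.
have -> : l - (beta t - alpha) / t = (t * l - (beta t - alpha)) / t.
  by field; rewrite gt_eqF.
rewrite normrM normfV (gtr0_norm t0) ler_pdivrMr// ler_norml.
apply/andP; split.
  suff : beta t <= alpha + t * (l + eta) by lra.
  rewrite -lee_fin bE; apply/ess_supP.
  have a_le : \forall x \ae mu, ((EFin \o a) x <= alpha%:E)%E.
    by rewrite aE; exact: ess_sup_ge.
  have ab_le : \forall x \ae mu, b t x <= a x + t * D x + eta / 2 * t.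
    by apply: filterS abt => x; rewrite ler_norml; lra.
  have D_le : \forall x \ae mu, D x <= M.
    by apply: filterS DM => x; rewrite ler_norml => /andP[].
  move/ess_sup_onP : ge0 => gx.
  near=> x.
  have ax : a x <= alpha by rewrite -lee_fin; near: x.
  have bx : b t x <= a x + t * D x + eta / 2 * t by near: x.
  have [xe0|xe0] := leP (alpha - e0) (a x); rewrite /= lee_fin.
    have Dx : D x <= l + eta / 2.
      rewrite -lee_fin; have /nearE := xe0; near: x; exact: gx.
    have : t * D x <= t * (l + eta / 2) by rewrite ler_pM2l.
    lra.
  have Dx : D x <= M by near: x.
  have tDx : t * D x <= t * M by rewrite ler_pM2l.
  have : t * (- M) <= t * l by rewrite ler_pM2l.
  have : 0 < t * eta by exact: mulr_gt0.
  lra.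
suff : alpha + t * (l - eta) <= beta t by lra.
rewrite leNgt; apply/negP => beta_lt.
(* [eps] is the supposed deficit: where [a x >= alpha - eps], the increment [b t x - a x] is at most
   [t * (l - eta)], so [D x <= l - eta / 2]. Hence [g eps < l], although [l] is the infimum of
   [g]. *)
pose eps := alpha + t * (l - eta) - beta t.
have eps0 : 0 < eps by rewrite subr_gt0.
have := L_le _ eps0; rewrite leNgt => /negP; apply.
apply: (@le_lt_trans _ _ (l - eta / 2)%:E); last by rewrite lte_fin; lra.
apply/ess_sup_onP.
have b_le : \forall x \ae mu, ((EFin \o b t) x <= (beta t)%:E)%E.
  by rewrite bE; exact: ess_sup_ge.
apply: filterS2 b_le abt => x; rewrite /= lee_fin => bx.
rewrite ler_norml => /andP[abx _] /nearE; rewrite /eps => ax.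
rewrite lee_fin -(ler_pM2l t0); lra.
Unshelve. all: by end_near. Qed.

End right_derivative.
End ess.

(** * First-order expansion from hypothesis (a) *)

Section expansion.
Context {R : realType} {X : normedModType R}.
Context {d : measure_display} {T : measurableType d}.
Variable mu : {measure set T -> \bar R}.

(* The null set in (a) depends on w, whereas the intermediate point given by the
   mean value theorem depends on x: hypothesis (a) is used only at the countably
   many points u + q phi with q rational, and continuity of the differential
   does the rest. *)
Lemma ae_first_order_expansion (F : X -> T -> R) (u phi : X) (eta : R) :
  (\forall x \ae mu, frechet_C1 (fun v => F v x)) ->
  ess_sup mu (fun x => `|'d (fun v => F v x) w phi -
                         'd (fun v => F v x) u phi|%:E) @[w --> u] --> 0%E ->
  0 < eta ->
  \forall t \near 0^'+, \forall x \ae mu,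
    `|F (u + t *: phi) x - F u x - t * 'd (fun v => F v x) u phi| <= eta * t.
Proof.
move=> F_C1 dF_cvg eta0.
have line_cvg : u + t *: phi @[t --> (0 : R)] --> u.
  rewrite -[X in _ --> X]addr0 -[X in _ --> _ + X](scale0r phi).
  by apply: cvgD; [exact: cvg_cst|apply: cvgZr_tmp; exact: cvg_id].
have dF_near := cvge_near_le (FG := nbhs_filter u) dF_cvg eta0.
have [delta /= delta0 dF_le] : \forall t \near (0 : R),
    (ess_sup mu (fun x => `|'d (fun v => F v x) (u + t *: phi) phi -
                            'd (fun v => F v x) u phi|%:E) <= eta%:E)%E.
  by apply: (line_cvg _ dF_near).
have ae_rat : \forall x \ae mu, forall q : rat, ratr q \in `]0, delta[ ->
    `|'d (fun v => F v x) (u + ratr q *: phi) phi -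
      'd (fun v => F v x) u phi| <= eta.
  apply: ae_forall_countable => q.
  have [|nq] := boolP (ratr q \in `]0, delta[); last exact: nearW.
  rewrite in_itv/= => /andP[q0 qdelta].
  have /ess_supP : (ess_sup mu (fun x => `|'d (fun v => F v x) (u + ratr q *: phi) phi -
      'd (fun v => F v x) u phi|%:E) <= eta%:E)%E.
    by apply: dF_le; rewrite /= sub0r normrN gtr0_norm.
  by apply: filterS => x; rewrite lee_fin.
near=> t.
apply: filterS2 F_C1 ae_rat => x Cx ratx.
apply: (frechet_C1_increment _ _ _ delta) => //.
by apply/andP; split; near: t; [exact: nbhs_right_gt|exact: nbhs_right_lt].
Unshelve. all: by end_near. Qed.

(** At one fixed [t], the expansion with error 1 compares the differential with a difference
    quotient of two essentially bounded functions. *)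
Lemma ae_differential_bounded (F : X -> T -> R) (u phi : X) :
  (forall v, F v \in Lfun mu +oo%E) ->
  (\forall x \ae mu, frechet_C1 (fun v => F v x)) ->
  ess_sup mu (fun x => `|'d (fun v => F v x) w phi -
                         'd (fun v => F v x) u phi|%:E) @[w --> u] --> 0%E ->
  exists2 M, 0 <= M & \forall x \ae mu, `|'d (fun v => F v x) u phi : R| <= M.
Proof.
move=> F_Linfty F_C1 dF_cvg.
have [t [t0 exp]] : exists t : R, 0 < t /\ \forall x \ae mu,
    `|F (u + t *: phi) x - F u x - t * 'd (fun v => F v x) u phi| <= 1 * t.
  apply: (@filter_ex _ (0 : R)^'+); apply: filterS2; last first.
  - exact: (ae_first_order_expansion _ _ _ _ F_C1 dF_cvg ltr01).
  - exact: (@nbhs_right_gt R 0).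
  by [].
have [M1 FM1] := Lfun_oo_bounded mu _ (F_Linfty (u + t *: phi)).
have [M2 FM2] := Lfun_oo_bounded mu _ (F_Linfty u).
exists `|(M1 + M2 + t) / t| => //.
apply: filterS3 exp FM1 FM2 => x exp FM1 FM2.
apply: le_trans (ler_norm _); rewrite ler_pdivlMr//.
rewrite -[X in _ * X](gtr0_norm t0) -normrM.
move: exp FM1 FM2; rewrite !ler_norml; lra.
Qed.

End expansion.

Theorem theorem2 (R : realType) (X : completeNormedModType R)
  (d : measure_display) (Omega : measurableType d)
  (lambda : {measure set Omega -> \bar R})
  (F : X -> Omega -> R)
  (F_Linfty : forall u : X, F u \in Lfun lambda +oo%E)
  (F_C1 : \forall x \ae lambda, frechet_C1 (fun u : X => F u x))
  (hyp_a : forall v phi : X,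
    ess_sup lambda (fun x => `|('d (fun u : X => F u x) w : X -> R) phi -
                               ('d (fun u : X => F u x) v : X -> R) phi|%:E)
      @[w --> v] --> 0%E)
  (hyp_b : forall v : X,
    ess_sup lambda (fun x => `|F w x - F v x|%:E) @[w --> v] --> 0%E)
  (f : X -> R)
  (f_def : forall u : X, (f u)%:E = ess_sup lambda (fun x => (F u x)%:E)) :
  (forall u : X, gateaux_semi_differentiable f u) /\
  (forall u phi : X,
    ess_sup_on lambda (near_ess_sup lambda (F u) eps)
        (fun x => (('d (fun v : X => F v x) u : X -> R) phi)%:E)
      @[eps --> 0^'+] --> (right_semi_derivative f u phi)%:E).
Proof.
(* One real [l] is the limit of both expressions, which yields differentiability and the formula
   together. *)
have main u phi : exists l : R,
    ess_sup_on lambda (near_ess_sup lambda (F u) eps)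
        (fun x => (('d (fun v : X => F v x) u : X -> R) phi)%:E)
      @[eps --> 0^'+] --> l%:E /\
    semi_quotient f u phi t @[t --> 0^'+] --> l.
  have [M M0 DM] := ae_differential_bounded _ _ _ phi F_Linfty F_C1 (hyp_a u phi).
  apply: (ess_sup_right_derivative lambda (F u) _ (fun t => F (u + t *: phi))
            (f u) (fun t => f (u + t *: phi)) M) => // eta eta0.
  exact: ae_first_order_expansion.
split=> u phi; have [l [gl ql]] := main u phi.
  by apply/cvg_ex; exists l.
by rewrite /right_semi_derivative (cvg_lim _ ql).
Qed.
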